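(* Let $\gamma\in(0,\tfrac12)$. Let $X_t^{(i)}$, $i=1,\dots,M$, solve the classical continuous-time Ensemble Kalman Filter equation and, for step size $h=T/L$, let $X_{t_k}^{(i),a}$ be produced by the classical discrete Ensemble Kalman Filter algorithm (both as defined in the context). Suppose the initial ensembles satisfy $$\sum_{i=1}^M \mathbb{E}\left[\left\|X_0^{(i),a}-X_0^{(i)}\right\|^2\right]\in O\left(h^{2\gamma}\right),$$ $$\sum_{i=1}^M \mathbb{E}\left[\left\|X_0^{(i),a}-\bar x_0^{a}\right\|^2\right]<\infty,\qquad \mathbb{E}\left[\left(\sum_{i=1}^M\left\|X_0^{(i),a}-\bar x_0^{a}\right\|^2\right)^2\right]<\infty,$$ the last two bounds being uniform in $h$. Let $(L(s))_{s\ge0}$ be a continuous real-valued process, not depending on $h$, for which $$\sup_{t\in[0,T]}\mathbb{E}\left[e^{-\int_0^t 2L(s)\,ds}\left(\sum_{i=1}^M\left\|X_{\eta(t)}^{(i),a}-X_t^{(i)}\right\|^2\right)\right]\in O\left(h^{2\gamma}\right).$$ If, moreover, there exists $\delta>0$ such that $$\sup_{t\in[0,T]}\mathbb{E}\left[e^{2\delta\int_0^tL(s)\,ds}\right]<\infty,$$ then $$\sup_{t\in[0,T]}\mathbb{E}\left[\left(\sum_{i=1}^M\left\|X_{\eta(t)}^{(i),a}-X_t^{(i)}\right\|^2\right)^{\frac{\delta}{1+\delta}}\right]\in O\left(h^{2\gamma\frac{\delta}{1+\delta}}\right).$$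
   Context: Signal and observation. Let $f:\mathbb{R}^d\to\mathbb{R}^d$ and $g:\mathbb{R}^d\to\mathbb{R}^p$ be bounded and Lipschitz continuous, and let $Q\in\mathbb{R}^{d\times d}$, $C\in\mathbb{R}^{p\times p}$ be symmetric positive definite. On a probability space $(\Omega,\mathcal F,\mathbb P)$, the reference signal $X^{\mathrm{ref}}$ solves $dX^{\mathrm{ref}}_t=f(X^{\mathrm{ref}}_t)dt+Q^{1/2}dW_t$ and the observation process solves $dY_t=g(X^{\mathrm{ref}}_t)dt+C^{1/2}dV_t$, with $W,V$ standard Brownian motions in $\mathbb{R}^d,\mathbb{R}^p$ and $X^{\mathrm{ref}}_0,W,V$ mutually independent. Fix an ensemble size $M\ge2$ and a time horizon $T>0$. Let $W^{(i)}$ ($d$-dimensional) and $V^{(i)}$ ($p$-dimensional), $i=1,\dots,M$, be independent standard Brownian motions, independent of $W,V,X_0^{\mathrm{ref}}$; the initial ensembles are independent of all the Brownian motions. Classical continuous-time filter: $$dX_t^{(i)}=f(X_t^{(i)})dt+Q^{1/2}dW_t^{(i)}+\tfrac1{M-1}E_t\mathcal G_t^TC^{-1}\left(dY_t+C^{1/2}dV_t^{(i)}-g(X_t^{(i)})dt\right),\quad i=1,\dots,M,$$ where $\bar x_t=\frac1M\sum_iX_t^{(i)}$, $\bar g_t=\frac1M\sum_i g(X_t^{(i)})$, $E_t\in\mathbb{R}^{d\times M}$ has columns $X_t^{(i)}-\bar x_t$, and $\mathcal G_t\in\mathbb{R}^{p\times M}$ has columns $g(X_t^{(i)})-\bar g_t$.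 Classical discrete algorithm. For $L\in\mathbb{N}$ let $h=T/L$, $t_k=kh$, $0\le k\le L$, and $\Delta Y_k=Y_{t_k}-Y_{t_{k-1}}$, $\tilde W_k^{(i)}=W^{(i)}_{t_k}-W^{(i)}_{t_{k-1}}$, $\tilde V_k^{(i)}=V^{(i)}_{t_k}-V^{(i)}_{t_{k-1}}$. (The integer $L$ is unrelated to the process $L(s)$.) Starting from an initial ensemble $X_0^{(i),a}$ (which may depend on $h$), for $k=1,\dots,L$: forecast: $X_{t_k}^{(i),f}=X_{t_{k-1}}^{(i),a}+hf(X_{t_{k-1}}^{(i),a})+Q^{1/2}\tilde W_k^{(i)}$; update: $X_{t_k}^{(i),a}=X_{t_k}^{(i),f}+K_k\left(\Delta Y_k+C^{1/2}\tilde V_k^{(i)}-hg(X_{t_k}^{(i),f})\right)$, with $K_k=\frac1{M-1}E_k^f(\mathcal G_k^f)^T\left(C+\frac h{M-1}\mathcal G_k^f(\mathcal G_k^f)^T\right)^{-1}$, where $E_k^f$, $\mathcal G_k^f$ are the matrices with columns $X_{t_k}^{(i),f}-\bar x_k^f$ and $g(X_{t_k}^{(i),f})-\bar g_k^f$, and $\bar x_k^f=\frac1M\sum_iX_{t_k}^{(i),f}$, $\bar g_k^f=\frac1M\sum_ig(X_{t_k}^{(i),f})$. Also $\bar x_k^a=\frac1M\sum_iX_{t_k}^{(i),a}$. Notation: $\eta(t)=t_{k-1}$ for $t\in[t_{k-1},t_k)$, and $\eta(T)=t_{L-1}$. $O(\cdot)$ refers to $h=T/L\to0$ with constants independent of $h$.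 *)

(* Defs.v *)
From HB Require Import structures.
From mathcomp Require Import all_boot all_order all_algebra.
From mathcomp Require Import all_classical all_reals all_analysis.
Set Implicit Arguments.
Unset Strict Implicit.
Unset Printing Implicit Defensive.
Import Order.TTheory GRing.Theory Num.Theory.
Import numFieldNormedType.Exports.
Local Open Scope classical_set_scope.
Local Open Scope ring_scope.

Section LinearAlgebra.
Context {R : realType}.

(* The library norm on matrices is the sup norm; this one is the Euclidean
   (on matrices, Frobenius) norm. *)
Definition l2norm m n (A : 'M[R]_(m, n)) : R :=
  Num.sqrt (\sum_i \sum_j A i j ^+ 2).

Definition sym_posdef n (A : 'M[R]_n) : Prop :=
  A^T = A /\ forall v : 'cV[R]_n, v != 0 -> 0 < (v^T *m A *m v) 0 0.

(* A^{1/2}: the unique symmetric positive definite square root of a symmetric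
   positive definite A. *)
Definition sqrtmx n (A : 'M[R]_n) : 'M[R]_n :=
  xget 0 [set S | sym_posdef S /\ S *m S = A].

Definition bounded_lipschitz m n (f : 'cV[R]_m -> 'cV[R]_n) : Prop :=
  (exists b : R, forall x, l2norm (f x) <= b) /\
  (exists k : R, forall x y, l2norm (f x - f y) <= k * l2norm (x - y)).

Definition ens_mean M n (x : 'I_M -> 'cV[R]_n) : 'cV[R]_n :=
  M%:R^-1 *: \sum_i x i.

Definition ens_dev M n (x : 'I_M -> 'cV[R]_n) : 'M[R]_(n, M) :=
  \matrix_(a, i) (x i - ens_mean x) a 0.

Definition vintegral n (t : R) (u : R -> 'cV[R]_n) : 'cV[R]_n :=
  \col_j (\int[lebesgue_measure]_(s in `[0, t]) (u s j 0)).

(* Membership of a L in O(h^r) as h = T / L -> 0. *)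
Definition bigO_step (T : R) (a : nat -> \bar R) (r : R) : Prop :=
  exists c : R, \forall L \near \oo, (a L <= (c * (T / L%:R) `^ r)%:E)%E.

(* The index k such that eta(t) = t_k = k * (T / L). *)
Definition eta_index (T : R) (L : nat) (t : R) : nat :=
  minn (Num.truncn (t / (T / L%:R))) L.-1.

Lemma eta_indexE (T : R) (L k : nat) (t : R) : 0 < T -> (k < L)%N ->
  k%:R * (T / L%:R) <= t < k.+1%:R * (T / L%:R) -> eta_index T L t = k.
Proof.
move=> T0 kL /andP[kt tk].
have L0 : (0 < L)%N by exact: leq_ltn_trans kL.
have h0 : 0 < T / L%:R by rewrite divr_gt0 // ltr0n.
have -> : eta_index T L t = minn k L.-1.
  by rewrite /eta_index (@truncn_def _ _ k) // ler_pdivlMr // kt ltr_pdivrMr.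
by apply/minn_idPl; rewrite -ltnS prednK.
Qed.

Lemma eta_index_horizon (T : R) (L : nat) : 0 < T -> (0 < L)%N ->
  eta_index T L T = L.-1.
Proof.
move=> T0 L0; rewrite /eta_index invf_div mulrC divfK ?gt_eqF//.
by rewrite natrK; apply/minn_idPr; exact: leq_pred.
Qed.

End LinearAlgebra.

Section Stochastic.
Context {R : realType} {dsp : measure_display} {Omega : measurableType dsp}.
Variable P : probability Omega R.

Definition mx_measurable (G : set_system Omega) m n (X : Omega -> 'M[R]_(m, n))
    : Prop :=
  forall i j, preimage_set_system setT (fun w => X w i j) measurable `<=` G.

(* The events {X_t^(j) in B}, t in D; they generate sigma(X_t : t in D). *)
Definition events I (D : set I) n (X : I -> Omega -> 'cV[R]_n)
    : set_system Omega :=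
  \bigcup_(t in D) \bigcup_(j in [set: 'I_n])
    preimage_set_system setT (fun w => X t w j 0) measurable.

Definition independent2 (G H : set_system Omega) : Prop :=
  forall A B, G A -> H B -> P (A `&` B) = (P A * P B)%E.

Definition mutually_independent I (G : I -> set_system Omega) : Prop :=
  forall m (i : 'I_m -> I), injective i ->
  forall A : 'I_m -> set Omega, (forall k, G (i k) (A k)) ->
  P (\bigcap_(k in [set: 'I_m]) A k) = (\prod_(k < m) P (A k))%E.

Definition filtration (F : R -> set_system Omega) : Prop :=
  [/\ forall t, 0 <= t -> sigma_algebra setT (F t),
      forall t, 0 <= t -> F t `<=` measurable
    & forall s t, 0 <= s -> s <= t -> F s `<=` F t].

Definition adapted (F : R -> set_system Omega) (D : set R) n
    (X : R -> Omega -> 'cV[R]_n) : Prop :=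
  forall t, D t -> mx_measurable (F t) (X t).

Definition incr n (s : R) (X : R -> Omega -> 'cV[R]_n) : R -> Omega -> 'cV[R]_n :=
  fun t w => X t w - X s w.

(* [normal_prob m s] takes the standard deviation s, not the variance. *)
Definition brownian n (B : R -> Omega -> 'cV[R]_n) : Prop :=
  [/\ forall t, 0 <= t -> mx_measurable measurable (B t),
      {ae P, forall w, B 0 w = 0},
      {ae P, forall w, {within `[0, +oo[, continuous (fun t => B t w)}},
      forall s t, 0 <= s -> s <= t ->
        independent2 <<s events `[0, s] B >> <<s events [set t] (incr s B) >>
    & forall s t, 0 <= s -> s < t ->
        mutually_independent (fun j : 'I_n =>
          preimage_set_system setT (fun w => incr s B t w j 0) measurable) /\
        forall (j : 'I_n) (A : set R), measurable A ->
          P ((fun w => incr s B t w j 0) @^-1` A) =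
          normal_prob 0 (Num.sqrt (t - s)) A].

Record step_process m n := StepProcess {
  step_size : nat ;
  step_time : nat -> R ;
  step_val : nat -> Omega -> 'M[R]_(m, n) }.

Definition simple_process (F : R -> set_system Omega) m n
    (phi : step_process m n) : Prop :=
  [/\ 0 <= step_time phi 0,
      forall k, step_time phi k <= step_time phi k.+1,
      forall k, mx_measurable (F (step_time phi k)) (step_val phi k)
    & exists b : R, forall k w, l2norm (step_val phi k w) <= b].

Definition step_fun m n (phi : step_process m n) (s : R) (w : Omega)
    : 'M[R]_(m, n) :=
  \sum_(k < step_size phi)
    \1_(`[step_time phi k, step_time phi k.+1[ : set R) s *: step_val phi k w.

Definition step_integral m n (phi : step_process m n)
    (Z : R -> Omega -> 'cV[R]_n) (t : R) (w : Omega) : 'cV[R]_m :=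
  \sum_(k < step_size phi) step_val phi k w *m
    (Z (Num.min (step_time phi k.+1) t) w - Z (Num.min (step_time phi k) t) w).

Definition cvg0_in_probability (Z : nat -> Omega -> \bar R) : Prop :=
  forall e : R, 0 < e ->
    (fun m => P [set w | (e%:E <= Z m w)%E]) @ \oo --> 0%E.

(* J is the Ito integral of H against dZ over [0, t]: the limit in probability
   of the integrals of simple processes phi_m with
   \int_0^t |H - phi_m|^2 ds -> 0 in probability.  The integrator Z is a Brownian
   motion, or an Ito process with bounded drift and constant diffusion matrix;
   for the latter the same approximation determines
   \int H dZ = \int H (drift) ds + \int H (diffusion) dV. *)
Definition is_ito_integral (F : R -> set_system Omega) m n
    (H : R -> Omega -> 'M[R]_(m, n)) (Z : R -> Omega -> 'cV[R]_n) (t : R)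
    (J : Omega -> 'cV[R]_m) : Prop :=
  mx_measurable measurable J /\
  exists phi : nat -> step_process m n,
  [/\ forall l, simple_process F (phi l),
      cvg0_in_probability (fun l w =>
        (\int[lebesgue_measure]_(s in `[0%R, t])
          (l2norm (H s w - step_fun (phi l) s w) ^+ 2)%:E)%E)
    & cvg0_in_probability (fun l w =>
        (l2norm (step_integral (phi l) Z t w - J w))%:E)].

Definition additive_sde (F : R -> set_system Omega) (T : R) n
    (b : R -> Omega -> 'cV[R]_n) (S : 'M[R]_n) (B X : R -> Omega -> 'cV[R]_n)
    : Prop :=
  [/\ adapted F `[0, T] X,
      forall w, {within `[0, T], continuous (fun t => X t w)}
    & {ae P, forall w, forall t, 0 <= t <= T ->
        X t w = X 0 w + vintegral t (fun s => b s w) + S *m B t w}].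

End Stochastic.

Section EnsembleKalman.
Context {R : realType} {dsp : measure_display} {Omega : measurableType dsp}.
Variable P : probability Omega R.
Variables (d p M : nat).
Variables (f : 'cV[R]_d -> 'cV[R]_d) (g : 'cV[R]_d -> 'cV[R]_p).
Variables (Q : 'M[R]_d) (C : 'M[R]_p).

Definition noise_events (D : set R)
    (W : R -> Omega -> 'cV[R]_d) (V : R -> Omega -> 'cV[R]_p)
    (Wi : 'I_M -> R -> Omega -> 'cV[R]_d) (Vi : 'I_M -> R -> Omega -> 'cV[R]_p)
    : set_system Omega :=
  events D W `|` events D V `|`
  \bigcup_(i in [set: 'I_M]) (events D (Wi i) `|` events D (Vi i)).

Inductive source := SrcInit | SrcW | SrcV | SrcWi of 'I_M | SrcVi of 'I_M.

Definition source_sigma (x0 : Omega -> 'cV[R]_d)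
    (W : R -> Omega -> 'cV[R]_d) (V : R -> Omega -> 'cV[R]_p)
    (Wi : 'I_M -> R -> Omega -> 'cV[R]_d) (Vi : 'I_M -> R -> Omega -> 'cV[R]_p)
    (a : source) : set_system Omega :=
  match a with
  | SrcInit => <<s events [set: unit] (fun=> x0) >>
  | SrcW => <<s events `[0, +oo[ W >>
  | SrcV => <<s events `[0, +oo[ V >>
  | SrcWi i => <<s events `[0, +oo[ (Wi i) >>
  | SrcVi i => <<s events `[0, +oo[ (Vi i) >>
  end.

(* F is a filtration for which (W, V, W^(i), V^(i)) is jointly Brownian. *)
Definition noise_filtration (F : R -> set_system Omega)
    (W : R -> Omega -> 'cV[R]_d) (V : R -> Omega -> 'cV[R]_p)
    (Wi : 'I_M -> R -> Omega -> 'cV[R]_d) (Vi : 'I_M -> R -> Omega -> 'cV[R]_p)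
    : Prop :=
  [/\ filtration F,
      adapted F `[0, +oo[ W /\ adapted F `[0, +oo[ V,
      forall i, adapted F `[0, +oo[ (Wi i) /\ adapted F `[0, +oo[ (Vi i)
    & forall s, 0 <= s -> independent2 P (F s)
        <<s noise_events `[s, +oo[ (incr s W) (incr s V)
              (fun i => incr s (Wi i)) (fun i => incr s (Vi i)) >>].

Definition cont_gain (x : 'I_M -> 'cV[R]_d) : 'M[R]_(d, p) :=
  (M%:R - 1)^-1 *: (ens_dev x *m (ens_dev (g \o x))^T *m invmx C).

Definition enkbf_solution (F : R -> set_system Omega) (T : R)
    (Y : R -> Omega -> 'cV[R]_p)
    (Wi : 'I_M -> R -> Omega -> 'cV[R]_d) (Vi : 'I_M -> R -> Omega -> 'cV[R]_p)
    (X : 'I_M -> R -> Omega -> 'cV[R]_d) : Prop :=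
  let K s w := cont_gain (fun l => X l s w) in
  forall i,
  [/\ adapted F `[0, T] (X i),
      forall w, {within `[0, T], continuous (fun t => X i t w)}
    & forall t, 0 <= t <= T -> exists JY JV : Omega -> 'cV[R]_d,
      [/\ is_ito_integral P F K Y t JY,
          is_ito_integral P F (fun s w => K s w *m sqrtmx C) (Vi i) t JV
        & {ae P, forall w, X i t w =
            X i 0 w + vintegral t (fun s => f (X i s w)) + sqrtmx Q *m Wi i t w
            + (JY w + JV w - vintegral t (fun s => K s w *m g (X i s w)))}]].

Definition forecast (h : R) (x dW : 'I_M -> 'cV[R]_d) : 'I_M -> 'cV[R]_d :=
  fun i => x i + h *: f (x i) + sqrtmx Q *m dW i.

Definition disc_gain (h : R) (xf : 'I_M -> 'cV[R]_d) : 'M[R]_(d, p) :=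
  let E := ens_dev xf in
  let G := ens_dev (g \o xf) in
  (M%:R - 1)^-1 *:
    (E *m G^T *m invmx (C + (h / (M%:R - 1)) *: (G *m G^T))).

Definition update (h : R) (xf : 'I_M -> 'cV[R]_d) (dY : 'cV[R]_p)
    (dV : 'I_M -> 'cV[R]_p) : 'I_M -> 'cV[R]_d :=
  fun i => xf i +
    disc_gain h xf *m (dY + sqrtmx C *m dV i - h *: g (xf i)).

(* [Xa i k w] is the i-th analysis ensemble member at time t_k = k T / L. *)
Definition enkf_algorithm (T : R) (L : nat) (Y : R -> Omega -> 'cV[R]_p)
    (Wi : 'I_M -> R -> Omega -> 'cV[R]_d) (Vi : 'I_M -> R -> Omega -> 'cV[R]_p)
    (Xa : 'I_M -> nat -> Omega -> 'cV[R]_d) : Prop :=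
  let h := T / L%:R in
  (forall i, mx_measurable measurable (Xa i 0%N)) /\
  forall k, (k < L)%N -> forall i w,
    let t0 := k%:R * h in
    let t1 := k.+1%:R * h in
    let xf := forecast h (fun l => Xa l k w) (fun l => incr t0 (Wi l) t1 w) in
    Xa i k.+1 w = update h xf (incr t0 Y t1 w) (fun l => incr t0 (Vi l) t1 w) i.

End EnsembleKalman.

(* Main.v *)
(* Put theta = delta / (1 + delta), J = 2 int_0^t L and S for the squared ensemble
   error. Hoelder with exponents 1 / theta and 1 + delta applied to
   S^theta = (e^{-J} S)^theta * e^{theta J} gives
   E[S^theta] <= E[e^{-J} S]^theta * E[e^{delta J}]^{1 / (1 + delta)}, and both
   factors are bounded by hypothesis. Hoelder needs S and J to be measurable: for S
   this goes through every step of the algorithm, for J through joint measurability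
   of the continuous process L, the pointwise limit of step processes. *)
Require Import Defs.
From HB Require Import structures.
From mathcomp Require Import all_boot all_order all_algebra.
From mathcomp Require Import all_classical all_reals all_analysis.
From mathcomp Require Import measurable_realfun.
From mathcomp Require Import lra.
Set Implicit Arguments.
Unset Strict Implicit.
Unset Printing Implicit Defensive.
Import Order.TTheory GRing.Theory Num.Theory.
Import numFieldNormedType.Exports.
Local Open Scope classical_set_scope.
Local Open Scope ring_scope.

(** * Rounding to a grid and clamping *)

(** Used with [a = 0] to clamp grid times into the half-line on which the process is continuous:
    clamping does not enlarge the rounding error. *)
Lemma ler_dist_max {R : realType} (a x y : R) :
  `|Num.max x a - Num.max y a| <= `|x - y|.
Proof.
rewrite ler_norml; have := ler_norm (x - y); have := ler_norm (y - x).
rewrite (distrC y x); move: (`|x - y|) => e hyx hxy.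
have e0 : 0 <= e by lra.
by case: (leP x a) => ?; case: (leP y a) => ?; apply/andP; split; lra.
Qed.

Lemma dist_floor_grid {R : realType} (x : R) (N : nat) :
  `|x - (Num.floor (x * N.+1%:R))%:~R / N.+1%:R| <= N.+1%:R^-1.
Proof.
have /andP[lo hi] := floor_itv (x * N.+1%:R).
rewrite ler_norml -(ler_pM2r (ltr0Sn R N)) -[X in _ && X](ler_pM2r (ltr0Sn R N)).
rewrite mulrBl divfK// mulNr mulVf//.
by move: hi; rewrite intrD => hi; lra.
Qed.

(** * Measurability of random matrices under matrix operations *)

Section Measurability.
Context {R : realType} {dsp : measure_display} {Omega : measurableType dsp}.

(** A preimage splits along the countably many fibres of [c], and on each fibre the function agrees
    with a single [F i]. This is how functions of a rounded argument are shown measurable. *)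
Lemma measurable_fun_countable_index (I : countType) (c : Omega -> I)
    (F : I -> Omega -> R) :
  (forall i, measurable (c @^-1` [set i])) ->
  (forall i, measurable_fun setT (F i)) ->
  measurable_fun setT (fun w => F (c w) w).
Proof.
move=> mc mF _ B mB; rewrite setTI.
have -> : (fun w => F (c w) w) @^-1` B =
    \bigcup_i (c @^-1` [set i] `&` F i @^-1` B).
  by apply/seteqP; split=> [w Bw|w [i _ [/= <-]]//]; exists (c w).
apply: countable_bigcupT_measurable => [|i]; first exact: countableP.
by apply: measurableI => //; rewrite -[X in measurable X]setTI; exact: mF.
Qed.

Lemma measurable_floor_fiber (u : Omega -> R) (q : int) :
  measurable_fun setT u -> measurable ((Num.floor \o u) @^-1` [set q]).
Proof.
move=> mu; rewrite (_ : _ @^-1` _ = u @^-1` `[q%:~R, (q + 1)%:~R[).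
  by rewrite -[X in measurable X]setTI; exact: mu.
apply/seteqP; split=> w /=; first by move=> <-; rewrite in_itv/=; exact: floor_itv.
by rewrite in_itv/=; exact: floor_def.
Qed.

(** Reduces to measurability of [powR] in its base through 1/u = u (u^2)^(-1). Squaring makes the
    base nonnegative, where the power -1 is the inverse; at u = 0 both sides are 0. *)
Lemma measurable_fun_invr (u : Omega -> R) :
  measurable_fun setT u -> measurable_fun setT (fun w => (u w)^-1).
Proof.
move=> mu.
have -> : (fun w => (u w)^-1) = u \* (fun w => (u w ^+ 2) `^ (-1)).
  apply/funext => w /=; rewrite powR_inv1 ?sqr_ge0// expr2.
  have [->|u0] := eqVneq (u w) 0; first by rewrite invr0 mul0r.
  by rewrite invfM mulrA divff// mul1r.
apply: measurable_funM => //.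
by apply: measurableT_comp (measurable_powR _) _; exact: measurable_funX.
Qed.

Lemma mx_measurableP m n (X : Omega -> 'M[R]_(m, n)) :
  mx_measurable measurable X <->
  forall i j, measurable_fun setT (fun w => X w i j).
Proof.
split=> [mX i j _ B mB|mX i j _ [B mB <-]]; last exact: mX.
by apply: (mX i j); exists B.
Qed.

Lemma mx_measurable_cst m n (A : 'M[R]_(m, n)) :
  mx_measurable measurable (fun _ : Omega => A).
Proof. by apply/mx_measurableP => i j; exact: measurable_cst. Qed.

Lemma mx_measurableD m n (X Z : Omega -> 'M[R]_(m, n)) :
  mx_measurable measurable X -> mx_measurable measurable Z ->
  mx_measurable measurable (fun w => X w + Z w).
Proof.
move=> /mx_measurableP mX /mx_measurableP mZ; apply/mx_measurableP => i j.
by under eq_fun do rewrite mxE; exact: measurable_funD.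
Qed.

Lemma mx_measurableZ m n (u : Omega -> R) (X : Omega -> 'M[R]_(m, n)) :
  measurable_fun setT u -> mx_measurable measurable X ->
  mx_measurable measurable (fun w => u w *: X w).
Proof.
move=> mu /mx_measurableP mX; apply/mx_measurableP => i j.
by under eq_fun do rewrite mxE; exact: measurable_funM.
Qed.

Lemma mx_measurableB m n (X Z : Omega -> 'M[R]_(m, n)) :
  mx_measurable measurable X -> mx_measurable measurable Z ->
  mx_measurable measurable (fun w => X w - Z w).
Proof.
move=> mX mZ; under eq_fun do rewrite -scaleN1r.
by apply: mx_measurableD => //; exact: mx_measurableZ.
Qed.

Lemma mx_measurable_sum I (s : seq I) m n (X : I -> Omega -> 'M[R]_(m, n)) :
  (forall i, mx_measurable measurable (X i)) ->
  mx_measurable measurable (fun w => \sum_(i <- s) X i w).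
Proof.
move=> mX; apply/mx_measurableP => a b.
under eq_fun do rewrite summxE.
by apply: measurable_sum => i; move/mx_measurableP: (mX i); exact.
Qed.

Lemma mx_measurable_mul m n q (X : Omega -> 'M[R]_(m, n))
    (Z : Omega -> 'M[R]_(n, q)) :
  mx_measurable measurable X -> mx_measurable measurable Z ->
  mx_measurable measurable (fun w => X w *m Z w).
Proof.
move=> /mx_measurableP mX /mx_measurableP mZ; apply/mx_measurableP => i j.
under eq_fun do rewrite mxE.
by apply: measurable_sum => k; exact: measurable_funM.
Qed.

Lemma mx_measurable_tr m n (X : Omega -> 'M[R]_(m, n)) :
  mx_measurable measurable X -> mx_measurable measurable (fun w => (X w)^T).
Proof.
move=> /mx_measurableP mX; apply/mx_measurableP => i j.
by under eq_fun do rewrite mxE; exact: mX.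
Qed.

Lemma measurable_det n (X : Omega -> 'M[R]_n) :
  mx_measurable measurable X -> measurable_fun setT (fun w => \det (X w)).
Proof.
move=> /mx_measurableP mX; rewrite /determinant.
apply: measurable_sum => s; apply: measurable_funM; first exact: measurable_cst.
by apply: measurable_prod => i _; exact: mX.
Qed.

(** Where the determinant is nonzero, Cramer's rule gives each entry as a cofactor divided by the
    determinant. Elsewhere [invmx] returns the matrix itself, so both branches are measurable and so
    is the event that separates them. *)
Lemma mx_measurable_inv n (X : Omega -> 'M[R]_n) :
  mx_measurable measurable X -> mx_measurable measurable (fun w => invmx (X w)).
Proof.
move=> mX; have /mx_measurableP mX' := mX.
apply/mx_measurableP => i j.
have -> : (fun w => invmx (X w) i j) = (fun w => if \det (X w) == 0 then X w i j
    else (\det (X w))^-1 * cofactor (X w) j i).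
  apply/funext => w; rewrite /invmx unitmxE unitfE.
  by case: eqP => //= _; rewrite !mxE.
apply: measurable_fun_ifT => //.
- by apply: measurable_fun_eqr; [exact: measurable_det|exact: measurable_cst].
- apply: measurable_funM.
    by apply: measurable_fun_invr; exact: measurable_det.
  rewrite /cofactor; apply: measurable_funM; first exact: measurable_cst.
  apply: measurable_det; apply/mx_measurableP => a b.
  by under eq_fun do rewrite !mxE; exact: mX'.
Qed.

(** * Euclidean norm and Lipschitz maps of random vectors *)

Lemma l2norm_sqr m n (A : 'M[R]_(m, n)) :
  l2norm A ^+ 2 = \sum_i \sum_j A i j ^+ 2.
Proof.
by rewrite sqr_sqrtr//; do 2!apply: sumr_ge0 => ? _; exact: sqr_ge0.
Qed.

Lemma ler_norm_l2norm m n (A : 'M[R]_(m, n)) i j : `|A i j| <= l2norm A.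
Proof.
rewrite -sqrtr_sqr ler_sqrt; last first.
  by do 2!apply: sumr_ge0 => ? _; exact: sqr_ge0.
rewrite (bigD1 i)//= (bigD1 j)//= -addrA lerDl addr_ge0//.
  by apply: sumr_ge0 => ? _; exact: sqr_ge0.
by do 2!apply: sumr_ge0 => ? _; exact: sqr_ge0.
Qed.

Lemma measurable_l2norm_sqr m n (X : Omega -> 'M[R]_(m, n)) :
  mx_measurable measurable X -> measurable_fun setT (fun w => l2norm (X w) ^+ 2).
Proof.
move=> /mx_measurableP mX; under eq_fun do rewrite l2norm_sqr.
by do 2!apply: measurable_sum => ?; exact: measurable_funX.
Qed.

(* [f] is evaluated on a grid of mesh 1 / (N + 1): the rounded argument takes
   countably many values, so that only the convergence uses continuity. *)
Lemma mx_measurable_lipschitz m n (f : 'cV[R]_m -> 'cV[R]_n)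
    (x : Omega -> 'cV[R]_m) : bounded_lipschitz f ->
  mx_measurable measurable x -> mx_measurable measurable (fun w => f (x w)).
Proof.
move=> [_ [k flip]] /mx_measurableP mx; apply/mx_measurableP => i j.
rewrite {j}ord1.
pose code N w : 'cV[int]_m := \col_a Num.floor (x w a 0 * N.+1%:R).
pose grid N (q : 'cV[int]_m) : 'cV[R]_m := \col_a ((q a 0)%:~R / N.+1%:R).
pose u N w := f (grid N (code N w)) i 0.
apply: (@measurable_fun_cvg _ _ _ _ u) => [N|w _].
  apply: (measurable_fun_countable_index (F := fun q _ => f (grid N q) i 0)) => [q|q].
    have -> : code N @^-1` [set q] = \bigcap_(a in [set: 'I_m])
        ((Num.floor \o (fun w => x w a 0 * N.+1%:R)) @^-1` [set q a 0]).
      apply/seteqP; split=> [w /= <- a _ /=|w qw]; first by rewrite mxE.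
      by apply/colP => a; rewrite mxE; exact: qw.
    apply: fin_bigcap_measurable => // a _; apply: measurable_floor_fiber.
    by apply: measurable_funM => //; exact: measurable_cst.
  exact: measurable_cst.
(* Each of the [m] coordinates is rounded with error at most 1/(N+1), so the Euclidean error is at
   most sqrt m / (N+1). The absolute value is there because [k] may be negative. *)
have dist N : `|f (x w) i 0 - u N w| <= `|k| * Num.sqrt m%:R * N.+1%:R^-1.
  have -> : f (x w) i 0 - u N w = (f (x w) - f (grid N (code N w))) i 0.
    by rewrite !mxE.
  apply: le_trans (ler_norm_l2norm _ _ _) _; apply: le_trans (flip _ _) _.
  rewrite -mulrA; apply: le_trans (ler_wpM2r (sqrtr_ge0 _) (ler_norm k)) _.
  rewrite ler_wpM2l//.
  rewrite -[leRHS]ger0_norm ?mulr_ge0 ?sqrtr_ge0// -sqrtr_sqr.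
  rewrite exprMn sqr_sqrtr// ler_sqrt ?mulr_ge0 ?sqr_ge0//.
  have -> : (m%:R * N.+1%:R^-1 ^+ 2 : R) = \sum_(a < m) N.+1%:R^-1 ^+ 2.
    by rewrite sumr_const card_ord mulr_natl.
  apply: ler_sum => a _; rewrite big_ord1 !mxE -real_normK ?num_real//.
  rewrite lerXn2r ?nnegrE//.
  exact: dist_floor_grid.
apply/cvgrPdist_le => e e0.
set K := `|k| * Num.sqrt m%:R in dist.
(* [K] may vanish, so the tolerance is divided by [K + 1]. *)
have K1 : 0 < K + 1 by rewrite ltr_wpDl// mulr_ge0// sqrtr_ge0.
have eK : 0 < e / (K + 1) by rewrite divr_gt0.
near=> N.
apply: le_trans (dist N) _.
have : N.+1%:R^-1 < e / (K + 1).
  by near: N; exact: (near_infty_natSinv_lt (PosNum eK)).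
rewrite ltr_pdivlMr// => /ltW; apply: le_trans.
by rewrite mulrC ler_wpM2l// lerDl.
Unshelve. all: by end_near. Qed.

(** * Measurability of the discrete filter *)

Lemma mx_measurable_ens_dev M n (x : 'I_M -> Omega -> 'cV[R]_n) :
  (forall i, mx_measurable measurable (x i)) ->
  mx_measurable measurable (fun w => ens_dev (fun i => x i w)).
Proof.
move=> mx; apply/mx_measurableP => a i; under eq_fun do rewrite mxE.
have /mx_measurableP : mx_measurable measurable
    (fun w => x i w - ens_mean (fun l => x l w)); last exact.
apply: mx_measurableB => //; apply: mx_measurableZ; first exact: measurable_cst.
exact: mx_measurable_sum.
Qed.

Lemma mx_measurable_update d p M (g : 'cV[R]_d -> 'cV[R]_p) (C : 'M[R]_p)
    (h : R) (xf : 'I_M -> Omega -> 'cV[R]_d) (dY : Omega -> 'cV[R]_p)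
    (dV : 'I_M -> Omega -> 'cV[R]_p) (i : 'I_M) :
  bounded_lipschitz g ->
  (forall l, mx_measurable measurable (xf l)) -> mx_measurable measurable dY ->
  (forall l, mx_measurable measurable (dV l)) ->
  mx_measurable measurable
    (fun w => update g C h (fun l => xf l w) (dY w) (fun l => dV l w) i).
Proof.
move=> glip mxf mdY mdV.
have mg l : mx_measurable measurable (fun w => g (xf l w)).
  exact: mx_measurable_lipschitz.
have mG := mx_measurable_ens_dev mg.
have mGT := mx_measurable_tr mG.
apply: mx_measurableD => //; apply: mx_measurable_mul; last first.
  apply: mx_measurableB; last by apply: mx_measurableZ => //; exact: measurable_cst.
  by apply: mx_measurableD => //; apply: mx_measurable_mul => //; exact: mx_measurable_cst.
apply: mx_measurableZ; first exact: measurable_cst.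
apply: mx_measurable_mul.
  by apply: mx_measurable_mul => //; exact: mx_measurable_ens_dev.
apply: mx_measurable_inv; apply: mx_measurableD; first exact: mx_measurable_cst.
by apply: mx_measurableZ; [exact: measurable_cst|exact: mx_measurable_mul].
Qed.

Lemma mx_measurable_forecast d M (f : 'cV[R]_d -> 'cV[R]_d) (Q : 'M[R]_d)
    (h : R) (x dW : 'I_M -> Omega -> 'cV[R]_d) (i : 'I_M) :
  bounded_lipschitz f -> (forall l, mx_measurable measurable (x l)) ->
  (forall l, mx_measurable measurable (dW l)) ->
  mx_measurable measurable
    (fun w => forecast f Q h (fun l => x l w) (fun l => dW l w) i).
Proof.
move=> flip mx mdW; apply: mx_measurableD.
  apply: mx_measurableD => //; apply: mx_measurableZ; first exact: measurable_cst.
  exact: mx_measurable_lipschitz.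
by apply: mx_measurable_mul => //; exact: mx_measurable_cst.
Qed.

(** Induction on the step: one forecast and one update preserve measurability. The bound [k <= L]
    keeps the recursion within its range and the grid times in [0, T], where the driving processes
    are known to be measurable. *)
Lemma mx_measurable_enkf_algorithm d p M (f : 'cV[R]_d -> 'cV[R]_d)
    (g : 'cV[R]_d -> 'cV[R]_p) (Q : 'M[R]_d) (C : 'M[R]_p) (T : R) (L : nat)
    (Y : R -> Omega -> 'cV[R]_p) (Wi : 'I_M -> R -> Omega -> 'cV[R]_d)
    (Vi : 'I_M -> R -> Omega -> 'cV[R]_p) (Xa : 'I_M -> nat -> Omega -> 'cV[R]_d) :
  0 < T -> bounded_lipschitz f -> bounded_lipschitz g ->
  (forall t, 0 <= t <= T -> mx_measurable measurable (Y t)) ->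
  (forall i t, 0 <= t <= T -> mx_measurable measurable (Wi i t)) ->
  (forall i t, 0 <= t <= T -> mx_measurable measurable (Vi i t)) ->
  enkf_algorithm f g Q C T L Y Wi Vi Xa ->
  forall k i, (k <= L)%N -> mx_measurable measurable (Xa i k).
Proof.
move=> T0 flip glip mY mWi mVi [mXa0 XaS]; elim=> [//|k IH] i kL.
have L0 : (0 < L)%N by exact: leq_ltn_trans kL.
have tkT j : (j <= L)%N -> 0 <= j%:R * (T / L%:R) <= T.
  move=> jL; rewrite mulr_ge0 ?divr_ge0 ?(ltW T0)//=.
  by rewrite mulrCA ler_piMr ?(ltW T0)// ler_pdivrMr ?ltr0n// mul1r ler_nat.
have tk0 := tkT k (ltnW kL); have tk1 := tkT _ kL.
pose h := T / L%:R; pose t0 := k%:R * h; pose t1 := k.+1%:R * h.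
pose xf l w := forecast f Q h (fun j => Xa j k w) (fun j => incr t0 (Wi j) t1 w) l.
have mincr n (Z : R -> Omega -> 'cV[R]_n) :
    (forall t, 0 <= t <= T -> mx_measurable measurable (Z t)) ->
    mx_measurable measurable (incr t0 Z t1).
  by move=> mZ; apply: mx_measurableB; exact: mZ.
rewrite (_ : Xa i k.+1 = fun w => update g C h (fun l => xf l w) (incr t0 Y t1 w)
    (fun l => incr t0 (Vi l) t1 w) i); last by apply/funext => w; exact: XaS.
apply: (mx_measurable_update (xf := xf) (dY := incr t0 Y t1)
  (dV := fun l => incr t0 (Vi l) t1)) => // [l| |l]; first last.
- by apply: mincr; exact: mVi.
- exact: mincr.
apply: (mx_measurable_forecast (x := fun j => Xa j k)
  (dW := fun j => incr t0 (Wi j) t1)) => // j; first exact: IH (ltnW kL).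
by apply: mincr; exact: mWi.
Qed.

End Measurability.

(** * Time integrals of a continuous process *)

(** Path continuity makes the process jointly measurable in outcome and time, as a limit of
    processes piecewise constant in time; Tonelli then makes the partial integral over time
    measurable in the outcome. *)
Lemma measurable_fun_time_integral {R : realType} {dsp : measure_display}
    {Omega : measurableType dsp} (u : R -> Omega -> R) (t : R) :
  (forall s, 0 <= s -> measurable_fun setT (u s)) ->
  (forall w, {within `[0, +oo[, continuous (fun s => u s w)}) ->
  measurable_fun setT (fun w => \int[lebesgue_measure]_(s in `[0, t]) u s w).
Proof.
move=> mu cu.
pose D : set R := `[0, t]%classic.
pose grid N (q : int) : R := Num.max (q%:~R / N.+1%:R) 0.
pose code N (z : Omega * R) := Num.floor (z.2 * N.+1%:R).
(* The indicator extends the integrand by zero to all real times, and the clamp ensures that the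
   process is evaluated at nonnegative times only. *)
pose v (z : Omega * R) : R := \1_D z.2 * u (Num.max z.2 0) z.1.
have mv : measurable_fun setT v.
  apply: measurable_funM.
    apply: measurableT_comp; last exact: measurable_snd.
    by apply: measurable_indic; exact: measurable_itv.
  apply: (@measurable_fun_cvg _ _ _ _ (fun N z => u (grid N (code N z)) z.1))
      => [N|[w s] _ /=].
    apply: (measurable_fun_countable_index (c := code N)
      (F := fun q z => u (grid N q) z.1)) => q.
      apply: measurable_floor_fiber; apply: measurable_funM; last exact: measurable_cst.
      exact: measurable_snd.
    by apply: measurableT_comp; [apply: mu; rewrite le_max lexx orbT|exact: measurable_fst].
  (* Continuity holds only relative to the half-line, so the grid times must both converge to the
     clamped time and stay nonnegative. The clamp in [grid] provides the latter. *)
  have s0 : `[0, +oo[%classic (Num.max s 0) by rewrite /= in_itv/= le_max lexx orbT.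
  have cus := (subspace_continuousP _ _).1 (cu w) _ s0.
  apply: (cvg_comp (fun N => grid N (code N (w, s))) (u ^~ w) _ cus) => B /= nB.
  have : grid N (code N (w, s)) @[N --> \oo] --> Num.max s 0.
    apply/cvgrPdist_lt => e e0; near=> N.
    apply: (@le_lt_trans _ _ N.+1%:R^-1).
      exact: le_trans (ler_dist_max _ _ _) (dist_floor_grid s N).
    by near: N; exact: (near_infty_natSinv_lt (PosNum e0)).
  move=> /(_ _ nB); rewrite !near_simpl; apply: (@filterS _ \oo) => N /=; apply.
  by rewrite in_itv/= le_max lexx orbT.
(* On [D] the clamp is inactive, and off [D] the indicator kills the integrand. *)
have uE w : \int[lebesgue_measure]_(s in D) u s w =
    fine (\int[lebesgue_measure]_s (v (w, s))%:E)%E.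
  rewrite /Rintegral [in LHS]integral_mkcond; congr fine.
  apply: eq_integral => s _; rewrite patchE /v /indic/=; case: ifPn => sD.
    rewrite mul1r max_l//.
    by move: sD; rewrite inE /D /= in_itv /= => /andP[].
  by rewrite mul0r.
(* Tonelli applies to nonnegative functions, so positive and negative parts are integrated
   separately, just as the integral itself is defined. *)
have -> : (fun w => \int[lebesgue_measure]_(s in D) u s w) = fine \o
    (fubini_F lebesgue_measure (EFin \o v)^\+ \- fubini_F lebesgue_measure (EFin \o v)^\-)%E.
  apply/funext => w; rewrite uE [in LHS]integralE /=; congr (fine (_ - _)%E).
    by rewrite /fubini_F; apply: eq_integral => s _; rewrite !funeposE.
  by rewrite /fubini_F; apply: eq_integral => s _; rewrite !funenegE.
have mE : measurable_fun setT (EFin \o v) by exact/measurable_EFinP.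
apply: (@measurableT_comp _ _ _ _ _ _ fine).
  exact: fine_measurable.
apply: emeasurable_funB; apply: measurable_fun_fubini_tonelli_F => //.
- exact: measurable_funepos.
- exact: measurable_funeneg.
Unshelve. all: by end_near. Qed.

(** * Hoelder's inequality with an exponential weight *)

Lemma expectation_powR_exp_weight {R : realType} {dsp : measure_display}
    {Omega : measurableType dsp} (P : probability Omega R) (S J : Omega -> R)
    (delta : R) :
  0 < delta -> measurable_fun setT S -> measurable_fun setT J ->
  (forall w, 0 <= S w) ->
  ('E_P[fun w => (S w `^ (delta / (1 + delta)))%R] <=
   'E_P[fun w => (expR (- J w) * S w)%R] `^ (delta / (1 + delta)) *
   'E_P[fun w => expR (delta * J w)] `^ (1 + delta)^-1)%E.
Proof.
move=> d0 mS mJ S0; set theta := delta / (1 + delta).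
have d1 : 0 < 1 + delta by rewrite addr_gt0.
have th0 : 0 < theta by rewrite divr_gt0.
pose u w := (expR (- J w) * S w) `^ theta.
pose v w := expR (theta * J w).
have mexp k : measurable_fun setT (fun w => expR (k * J w)).
  by apply: measurableT_comp => //; apply: measurable_funM => //; exact: measurable_cst.
have mu : measurable_fun setT u.
  apply: measurableT_comp (measurable_powR _) _; apply: measurable_funM => //.
  by under eq_fun do rewrite -mulN1r; exact: mexp.
(* The exponents are conjugate because delta/(1+delta) + 1/(1+delta) = 1; the double inverse comes
   from taking [theta^-1] as the first exponent. *)
have conj : theta^-1^-1 + (1 + delta)^-1 = 1.
  by rewrite invrK /theta -[X in _ + X]mul1r -mulrDl [delta + 1]addrC divff// gt_eqF.
have := hoelder P mu (mexp theta) _ d1 conj; rewrite invr_gt0 => /(_ th0).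
rewrite Lnorm1 unlock !invrK expectation.unlock.
(* The weights exp(-theta J) in [u] and exp(theta J) in [v] cancel. *)
have -> : (\int[P]_w `|(EFin \o (u \* v)%R) w| = \int[P]_w (S w `^ theta)%:E)%E.
  apply: eq_integral => w _ /=; congr EFin.
  rewrite /u /v [theta * _]mulrC expRM -powRM ?mulr_ge0 ?expR_ge0//.
  by rewrite mulrAC -expRD addNr expR0 mul1r ger0_norm// powR_ge0.
have -> : (\int[P]_w `|(EFin \o u) w| `^ theta^-1 =
    \int[P]_w (expR (- J w) * S w)%:E)%E.
  apply: eq_integral => w _ /=; rewrite ger0_norm ?powR_ge0//; congr EFin.
  by rewrite -powRrM divff ?gt_eqF// powRr1// mulr_ge0// expR_ge0.
(* Here theta (1 + delta) = delta. *)
have -> : (\int[P]_w `|(EFin \o v) w| `^ (1 + delta) =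
    \int[P]_w (expR (delta * J w))%:E)%E.
  apply: eq_integral => w _ /=; rewrite ger0_norm ?expR_ge0//; congr EFin.
  by rewrite /v -expRM mulrAC divfK// gt_eqF.
by [].
Qed.

(** * Combination of the weighted error bound with the exponential moment bound *)

Theorem corollary4p2 (R : realType) (dsp : measure_display)
  (Omega : measurableType dsp) (P : probability Omega R)
  (d p M : nat) (T gamma delta : R)
  (f : 'cV[R]_d -> 'cV[R]_d) (g : 'cV[R]_d -> 'cV[R]_p)
  (Q : 'M[R]_d) (C : 'M[R]_p)
  (W : R -> Omega -> 'cV[R]_d) (V : R -> Omega -> 'cV[R]_p)
  (Wi : 'I_M -> R -> Omega -> 'cV[R]_d) (Vi : 'I_M -> R -> Omega -> 'cV[R]_p)
  (F : R -> set (set Omega))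
  (Xref : R -> Omega -> 'cV[R]_d) (Y : R -> Omega -> 'cV[R]_p)
  (X : 'I_M -> R -> Omega -> 'cV[R]_d)
  (Xa : nat -> 'I_M -> nat -> Omega -> 'cV[R]_d)
  (Lp : R -> Omega -> R)
  (hd : (0 < d)%N) (hp : (0 < p)%N) (hM : (1 < M)%N) (hT : 0 < T)
  (hgamma : 0 < gamma < 2^-1)
  (hf : bounded_lipschitz f) (hg : bounded_lipschitz g)
  (hQ : sym_posdef Q) (hC : sym_posdef C)
  (hW : brownian P W) (hV : brownian P V)
  (hWi : forall i, brownian P (Wi i)) (hVi : forall i, brownian P (Vi i))
  (hindep : mutually_independent P (source_sigma (Xref 0) W V Wi Vi))
  (hinit : forall L : nat, (0 < L)%N ->
    independent2 P
      <<s events [set: 'I_M] (fun i => X i 0) `|`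
          events [set: 'I_M] (fun i => Xa L i 0%N) >>
      <<s noise_events `[0, +oo[ W V Wi Vi >>)
  (hF : noise_filtration P F W V Wi Vi)
  (hXref : additive_sde P F T (fun s w => f (Xref s w)) (sqrtmx Q) W Xref)
  (hY : additive_sde P F T (fun s w => g (Xref s w)) (sqrtmx C) V Y)
  (hX : enkbf_solution P f g Q C F T Y Wi Vi X)
  (hXa : forall L : nat, (0 < L)%N -> enkf_algorithm f g Q C T L Y Wi Vi (Xa L))
  (hinit_error : bigO_step T (fun L =>
    (\sum_(i < M)
       'E_P[fun w => ((l2norm (Xa L i 0%N w - X i 0 w)) ^+ 2)%R])%E)
    (2 * gamma))
  (hinit_spread2 : exists c : R, forall L : nat, (0 < L)%N ->
    (\sum_(i < M)
       'E_P[fun w =>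
         ((l2norm (Xa L i 0%N w - ens_mean (fun l => Xa L l 0%N w))) ^+ 2)%R]
     <= c%:E)%E)
  (hinit_spread4 : exists c : R, forall L : nat, (0 < L)%N ->
    ('E_P[fun w => ((\sum_(i < M)
         (l2norm (Xa L i 0%N w - ens_mean (fun l => Xa L l 0%N w))) ^+ 2)
           ^+ 2)%R]
     <= c%:E)%E)
  (hLp_meas : forall s, 0 <= s -> measurable_fun setT (Lp s))
  (hLp_cont : forall w, {within `[0, +oo[, continuous (fun s => Lp s w)})
  (hLp_error : bigO_step T (fun L =>
    ereal_sup [set ('E_P[fun w =>
      (expR (- \int[lebesgue_measure]_(s in `[0, t]) (2 * Lp s w)) *
       \sum_(i < M) (l2norm (Xa L i (eta_index T L t) w - X i t w)) ^+ 2)%R])%E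
      | t in `[0, T]])
    (2 * gamma))
  (hdelta : 0 < delta)
  (hLp_exp : (ereal_sup [set ('E_P[fun w =>
      expR (2 * delta * \int[lebesgue_measure]_(s in `[0, t]) (Lp s w))%R])%E
      | t in `[0%R, T]] < +oo)%E) :
  bigO_step T (fun L =>
    ereal_sup [set ('E_P[fun w =>
      ((\sum_(i < M) (l2norm (Xa L i (eta_index T L t) w - X i t w)) ^+ 2)
        `^ (delta / (1 + delta)))%R])%E
      | t in `[0, T]])
    (2 * gamma * (delta / (1 + delta))).
Proof.
have pos_itv t : 0 <= t <= T -> 0 <= t by case/andP.
have mB n (B : R -> Omega -> 'cV[R]_n) : brownian P B ->
    forall t, 0 <= t <= T -> mx_measurable measurable (B t).
  by case=> mB _ _ _ _ t /pos_itv; exact: mB.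
have mF n (Z : R -> Omega -> 'cV[R]_n) : adapted F `[0, T] Z ->
    forall t, 0 <= t <= T -> mx_measurable measurable (Z t).
  move=> aZ t tT i j; apply: subset_trans (aZ t _ i j) _; first by rewrite /= in_itv.
  by case: hF => -[_ Fmeas _] _ _ _; apply: Fmeas; exact: pos_itv.
have mXa L i k : (0 < L)%N -> (k <= L)%N -> mx_measurable measurable (Xa L i k).
  move=> L0; have mY : forall t, 0 <= t <= T -> mx_measurable measurable (Y t).
    by apply: mF; case: hY.
  exact: (mx_measurable_enkf_algorithm hT hf hg mY (fun j => mB _ _ (hWi j))
    (fun j => mB _ _ (hVi j)) (hXa L L0)).
have mX i t : 0 <= t <= T -> mx_measurable measurable (X i t).
  by apply: mF; case: (hX i).
pose S L t w := \sum_(i < M) (l2norm (Xa L i (eta_index T L t) w - X i t w)) ^+ 2.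
have mS L t : (0 < L)%N -> 0 <= t <= T -> measurable_fun setT (S L t).
  move=> L0 tT; apply: measurable_sum => i; apply: measurable_l2norm_sqr.
  apply: mx_measurableB; last exact: mX.
  (* [eta_index] is capped at [L.-1], so it never exceeds the number of steps, even at t = T. *)
  by apply: mXa => //; exact: leq_trans (geq_minr _ _) (leq_pred _).
pose J t w := \int[lebesgue_measure]_(s in `[0, t]) (2 * Lp s w).
(* The factor 2 stands inside the integral in one hypothesis and outside it in the other. Pulling it
   out requires integrability, which follows from continuity on a compact interval. *)
have JE t w : J t w = 2 * \int[lebesgue_measure]_(s in `[0, t]) Lp s w.
  rewrite /J RintegralZl//.
  apply: continuous_compact_integrable; first exact: segment_compact.
  apply: continuous_subspaceW (hLp_cont w) => s /=.
  by rewrite !in_itv/= andbT => /andP[].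
have mJ t : measurable_fun setT (fun w => J t w).
  under eq_fun do rewrite JE.
  apply: measurable_funM; first exact: measurable_cst.
  exact: measurable_fun_time_integral.
have d1 : 0 < 1 + delta by rewrite addr_gt0.
set theta := delta / (1 + delta).
have th0 : 0 <= theta by rewrite divr_ge0// ltW.
have [K [K0 EK]] : exists K : R, 0 <= K /\ forall t, 0 <= t <= T ->
    ('E_P[fun w => expR (delta * J t w)] <= K%:E)%E.
  set s := ereal_sup _ in hLp_exp.
  have Es t : 0 <= t <= T -> ('E_P[fun w => expR (delta * J t w)] <= s)%E.
    move=> tT; apply: ereal_sup_ubound; exists t; first by rewrite /= in_itv.
    by congr expectation; apply/funext => w; rewrite JE mulrA [delta * 2]mulrC.
  (* The expectation at time 0 witnesses that the supremum is nonnegative; with the bound below +oo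
     it is therefore finite, and [fine s] can serve as [K]. *)
  have s0 : (0%E <= s)%E.
    apply: le_trans (Es 0 _); last by rewrite lexx ltW.
    by apply: expectation_ge0 => w; exact: expR_ge0.
  have sfin : s \is a fin_num by rewrite ge0_fin_numE.
  by exists (fine s); split=> [|t tT]; rewrite ?fine_ge0// fineK// Es.
have [c cE] := hLp_error.
(* The constant is what Hoelder leaves after h^(2 gamma theta) is split off. The absolute value
   makes the base nonnegative, so that the power of the product factors. *)
exists (`|c| `^ theta * K `^ (1 + delta)^-1).
near=> L.
(* The algorithm is assumed only for positive [L], which holds eventually. *)
have L0 : (0 < L)%N by near: L; exact: nbhs_infty_gt.
apply: ge_ereal_sup => _ [t tT <-]; rewrite /= in_itv/= in tT.
have S0 w : 0 <= S L t w by apply: sumr_ge0 => i _; exact: sqr_ge0.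
apply: le_trans (expectation_powR_exp_weight P hdelta (mS L t L0 tT) (mJ t) S0) _.
have EZ : ('E_P[fun w => (expR (- J t w) * S L t w)%R] <=
    (`|c| * (T / L%:R) `^ (2 * gamma))%:E)%E.
  apply: (@le_trans _ _ (c * (T / L%:R) `^ (2 * gamma))%:E).
    have cL : (ereal_sup [set ('E_P[fun w => (expR (- J t w) * S L t w)%R])%E
        | t in `[0%R, T]] <= (c * (T / L%:R) `^ (2 * gamma))%:E)%E.
      by near: L; exact: cE.
    apply: le_trans cL; apply: ereal_sup_ubound; exists t => //=; rewrite in_itv.
  by rewrite lee_fin ler_wpM2r ?powR_ge0// ler_norm.
have -> : `|c| `^ theta * K `^ (1 + delta)^-1 * (T / L%:R) `^ (2 * gamma * theta) =
    (`|c| * (T / L%:R) `^ (2 * gamma)) `^ theta * K `^ (1 + delta)^-1.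
  by rewrite (powRM _ (normr_ge0 c) (powR_ge0 _ _)) -powRrM mulrAC.
rewrite EFinM -!poweR_EFin.
have EZ0 : (0%E <= 'E_P[fun w => (expR (- J t w) * S L t w)%R])%E.
  by apply: expectation_ge0 => w; rewrite mulr_ge0// expR_ge0.
have EJ0 : (0%E <= 'E_P[fun w => expR (delta * J t w)])%E.
  by apply: expectation_ge0 => w; exact: expR_ge0.
have d1V : 0 <= (1 + delta)^-1 by rewrite invr_ge0 ltW.
(* Both factors are nonnegative, and powers with nonnegative exponent are monotone on [0, +oo], so
   the two expectation bounds transfer to the product. *)
apply: lee_pmul; rewrite ?poweR_ge0//.
- by apply: gt0_ler_poweR => //; rewrite in_itv/= leey andbT// (le_trans EZ0).
- by apply: gt0_ler_poweR; rewrite ?EK// in_itv/= leey andbT// lee_fin.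
Unshelve. all: by end_near. Qed.
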